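(* Let $n,k,N\in\mathbb N$, let $\Omega\subseteq\mathbb R^n$ be an open set, and let $\mathrm H:\Omega\times\mathbb R^{\vec M}\to\mathbb R$ be a Carathéodory function. Consider the functional $\mathrm E_\infty$ on $W^{k,\infty}(\Omega;\mathbb R^N)\times\mathcal L(\Omega)$ given by $$\mathrm E_\infty(u,\mathcal O)=\operatorname*{ess\,sup}_{\mathcal O}\mathrm H(\cdot,D^{\vec k}u).$$ Suppose that $\mathrm H(x,\cdot)$ is in $C^1(\mathbb R^{\vec M})$ essentially uniformly in $x\in\Omega$, namely for any $R>0$ there exists an increasing modulus of continuity $\omega_R\in C(0,\infty)$ with $\omega_R(0^+)=0$ such that $$\operatorname*{ess\,sup}_{\Omega}\big|\mathrm H(\cdot,\mathbf X'')-\mathrm H(\cdot,\mathbf X')\big|\le\omega_R(|\mathbf X''-\mathbf X'|),\qquad \operatorname*{ess\,sup}_{\Omega}\big|\mathrm H_{,\mathbf X}(\cdot,\mathbf X'')-\mathrm H_{,\mathbf X}(\cdot,\mathbf X')\big|\le\omega_R(|\mathbf X''-\mathbf X'|)$$ for all $\mathbf X'',\mathbf X'\in\mathbb B_R\subseteq\mathbb R^{\vec M}$. Suppose also that $|\mathrm H(\cdot,\mathbf 0)|\in L^\infty(\Omega)$. Then $\mathrm E_\infty(\cdot,\Omega)$ is (Gateaux) semi-differentiable everywhere on $W^{k,\infty}(\Omega;\mathbb R^N)$, and its right semi-differential can be represented as $$\big(\mathfrak D\mathrm E_\infty(\cdot,\Omega)\big)^+_u(\phi)=\lim_{\varepsilon\to0^+}\Bigg(\operatorname*{ess\,sup}_{\{\mathrm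 H(\cdot,D^{\vec k}u)\ge\mathrm E_\infty(u,\Omega)-\varepsilon\}}\Big[\mathrm H_{,\mathbf X}(\cdot,D^{\vec k}u):D^{\vec k}\phi\Big]\Bigg)$$ for any $u,\phi\in W^{k,\infty}(\Omega;\mathbb R^N)$.
   Context: Notation: $\mathbb R^{N\times n^{\otimes j}}_{\mathrm s}$ is the space of tensors in $\mathbb R^N\otimes(\mathbb R^n)^{\otimes j}$ that are symmetric in the last $j$ indices, and $\mathbb R^{\vec M}:=\mathbb R^N\times\mathbb R^{N\times n}\times\cdots\times\mathbb R^{N\times n^{\otimes k}}_{\mathrm s}$, with Euclidean inner product ''$:$'' and Euclidean norm $|\cdot|$; $\mathbb B_R$ is the open ball of radius $R$ centred at $0$. $D^{\vec k}u:=(u,Du,\dots,D^ku)$ is the $k$-jet. $\mathrm H$ is Carathéodory if $\mathrm H(\cdot,\mathbf X)$ is Lebesgue measurable for all $\mathbf X$ and $\mathrm H(x,\cdot)$ is continuous for a.e. $x$; $\mathrm H_{,\mathbf X}$ is the derivative in the second argument. $\mathcal L(\Omega)$ is the $\sigma$-algebra of Lebesgue measurable subsets of $\Omega$; essential suprema are with respect to Lebesgue measure. $W^{k,\infty}(\Omega;\mathbb R^N)$ has norm $\|D^{\vec k}u\|_{L^\infty(\Omega)}$; $\Omega$ is not assumed bounded. For a functional $f$ on a Banach space, the right semi-derivative is $(\mathfrak D f)^+_u(\phi):=\lim_{t\to0^+}\frac{f(u+t\phi)-f(u)}{t}$, and $f$ is Gateaux semi-differentiable at $u$ if this limit exists for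 all directions $\phi$. *)

(* Defs.v *)
From HB Require Import structures.
From mathcomp Require Import all_boot all_order all_algebra.
From mathcomp Require Import all_classical all_reals all_analysis.
From mathcomp Require Import measurable_realfun ess_sup_inf ring lra.

Set Implicit Arguments.
Unset Strict Implicit.
Unset Printing Implicit Defensive.

Import Order.TTheory GRing.Theory Num.Theory.
Import numFieldNormedType.Exports.

Local Open Scope classical_set_scope.
Local Open Scope ring_scope.

Section lebesgue.
Context {R : realType} {n : nat}.
Implicit Types (A : set 'rV[R]_n).

Definition box (c : 'rV[R]_n * 'rV[R]_n) : set 'rV[R]_n :=
  [set x | forall i, c.1 ord0 i <= x ord0 i <= c.2 ord0 i].

Definition box_vol (c : 'rV[R]_n * 'rV[R]_n) : R :=
  \prod_(i < n) Num.max 0 (c.2 ord0 i - c.1 ord0 i).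

(* [None] stands for the empty set, so that finite covers are allowed (for
   n = 0 no box is empty or of volume 0). *)
Definition oset (c : option ('rV[R]_n * 'rV[R]_n)) : set 'rV[R]_n :=
  oapp box set0 c.

Definition ovol (c : option ('rV[R]_n * 'rV[R]_n)) : \bar R :=
  (oapp box_vol 0 c)%:E.

(* Infimum of the total volume over all countable covers by boxes. *)
Definition lebesgue_outer A : \bar R :=
  ereal_inf [set (\sum_(j <oo) ovol (F j))%E
            | F in [set F | A `<=` \bigcup_j oset (F j)]].

Lemma ovol_ge0 c : (0 <= ovol c)%E.
Proof.
case: c => [c|] /=; rewrite lee_fin// /box_vol.
by apply: prodr_ge0 => i _; rewrite le_max lexx.
Qed.

Lemma lebesgue_outer_ge0 A : (0 <= lebesgue_outer A)%E.
Proof.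
apply: le_ereal_inf_tmp => _ [F _ <-].
by apply: nneseries_ge0 => j _ _; exact: ovol_ge0.
Qed.

Lemma lebesgue_outer0 : lebesgue_outer set0 = 0%E.
Proof.
apply/eqP; rewrite eq_le lebesgue_outer_ge0 andbT.
apply: ereal_inf_lbound; exists (fun=> None) => //=.
by rewrite eseries0.
Qed.

Lemma le_lebesgue_outer :
  {homo lebesgue_outer : A B / A `<=` B >-> (A <= B)%E}.
Proof.
move=> A B AB; apply: ereal_inf_le_tmp => _ [F BF <-].
by exists F => //; exact: subset_trans BF.
Qed.

Lemma lebesgue_outer_sigma_subadditive : sigma_subadditive lebesgue_outer.
Proof.
move=> A; have [[i ioo]|] := pselect (exists i, lebesgue_outer (A i) = +oo%E).
  rewrite (eseries_pinfty _ _ ioo) ?leey// => m _.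
  by rewrite -ltNye (lt_le_trans _ (lebesgue_outer_ge0 _)).
rewrite -forallNE => Aoo.
suff add2e (e : {posnum R}) : (lebesgue_outer (\bigcup_n A n) <=
    \sum_(i <oo) lebesgue_outer (A i) + e%:num%:E)%E.
  by apply/lee_addgt0Pr => _/posnumP[].
rewrite (le_trans _ (epsilon_trick _ _ _))//; last first.
  by move=> m; exact: lebesgue_outer_ge0.
pose P m (F : nat -> option ('rV[R]_n * 'rV[R]_n)) :=
  A m `<=` \bigcup_j oset (F j) /\
  (\sum_(j <oo) ovol (F j) <=
    lebesgue_outer (A m) + (e%:num / (2 ^ m.+1)%:R)%:E)%E.
have [G PG] : {G : nat -> _ & forall m, P m (G m)}.
  apply: (@choice _ _ P) => m; rewrite /P.
  have fin : lebesgue_outer (A m) \is a fin_num.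
    by rewrite ge0_fin_numE ?lebesgue_outer_ge0// ltey; apply/eqP/Aoo.
  have em : 0 < e%:num / (2 ^ m.+1)%:R by rewrite divr_gt0// ltr0n expn_gt0.
  have [_ [F AF <-] /ltW xS] := lb_ereal_inf_adherent em fin.
  by exists F; split.
have G_ge0 x : (0 <= (ovol \o uncurry G) x)%E by exact: ovol_ge0.
apply: (@le_trans _ _ (\esum_(i in setT) (ovol \o uncurry G) i)%E).
  apply: ereal_inf_lbound => /=.
  have /card_esym/ppcard_eqP[f] := card_nat2.
  exists (uncurry G \o f).
    move=> t [i _ /(PG i).1 [j _ Bijt]]; exists (f^-1%FUN (i, j)) => //=.
    by rewrite invK ?inE.
  rewrite -(esum_pred_image (ovol \o uncurry G) _ xpredT) ?[fun=> _]set_true//.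
  by rewrite image_eq.
rewrite (_ : esum _ _ = \sum_(i <oo) \sum_(j <oo) ovol (G i j))%E; last first.
  pose J : nat -> set (nat * nat) := fun i => [set (i, j) | j in setT].
  rewrite (_ : setT = \bigcup_k J k); last first.
    by rewrite predeqE => -[a b]; split => // _; exists a => //; exists b.
  rewrite esum_bigcupT /=; last 2 first.
  - apply/trivIsetP => i j _ _ ij.
    rewrite predeqE => -[n1 m1] /=; split => //= -[] [_] _ [<-{n1} _].
    by move=> [m' _] [] /esym/eqP; rewrite (negbTE ij).
  - by move=> x; exact: G_ge0.
  rewrite -(image_id [set: nat]) -fun_true esum_pred_image//; last first.
    by move=> m _; apply: esum_ge0 => x _; exact: G_ge0.
  apply: eq_eseriesr => /= j _.
  rewrite -(esum_pred_image (ovol \o uncurry G) (pair j) predT)//=; last 2 first.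
  - by move=> m _; exact: ovol_ge0.
  - by move=> ? ? _ _; exact: (@can_inj _ _ _ snd).
  by congr esum; rewrite predeqE => -[a b]; split; move=> [i _ <-]; exists i.
apply: lee_nneseries => [m _ _|m _]; last exact: (PG m).2.
by apply: nneseries_ge0 => j _ _; exact: ovol_ge0.
Qed.

HB.instance Definition _ := isOuterMeasure.Build R 'rV[R]_n lebesgue_outer
  lebesgue_outer0 lebesgue_outer_ge0 le_lebesgue_outer
  lebesgue_outer_sigma_subadditive.

End lebesgue.

(* R^n with the sigma-algebra of all sets that are Carathéodory measurable for
   the outer measure, i.e., the (complete) Lebesgue sigma-algebra. *)
Definition lebT (R : realType) (n : nat) :
    measurableType (caratheodory_display (@lebesgue_outer R n)) :=
  caratheodory_type (@lebesgue_outer R n).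

Definition leb (R : realType) (n : nat) : {measure set (lebT R n) -> \bar R} :=
  HB.pack_for (measure (lebT R n) R) (@lebesgue_outer R n : set (lebT R n) -> \bar R)
    (isMeasure.Build _ (lebT R n) R (@lebesgue_outer R n : set (lebT R n) -> \bar R)
      lebesgue_outer0 lebesgue_outer_ge0
      (@caratheodory_measure_sigma_additive R 'rV[R]_n (@lebesgue_outer R n))).

Section jets.
Context {R : realType} (N n k : nat).

(* The component of index (i, (i_1, ..., i_j)), j <= k, is the entry
   X_{i, i_1 ... i_j} of the j-th factor of R^N x R^(N x n) x ... . *)
Definition jidx : finType := ('I_N * k.-bseq 'I_n)%type.

Definition jet_sym : {pred {ffun jidx -> R}} :=
  [pred X : {ffun jidx -> R} | [forall i : 'I_N, forall J : k.-bseq 'I_n,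
     forall J' : k.-bseq 'I_n, perm_eq J J' ==> (X (i, J) == X (i, J'))]].

Lemma jet_symP (X : {ffun jidx -> R}) :
  reflect (forall i (J J' : k.-bseq 'I_n), perm_eq J J' -> X (i, J) = X (i, J'))
          (X \in jet_sym).
Proof.
apply: (iffP forallP) => /= [H i J J' JJ'|H i].
  by have /forallP/(_ J)/forallP/(_ J')/implyP/(_ JJ')/eqP := H i.
apply/forallP => J; apply/forallP => J'; apply/implyP => JJ'.
exact/eqP/H.
Qed.

Lemma jet_sym_submod_closed : submod_closed jet_sym.
Proof.
split=> [|a X Y /jet_symP sX /jet_symP sY]; apply/jet_symP => i J J' JJ'.
  by rewrite !ffunE.
by rewrite !ffunE (sX _ _ _ JJ') (sY _ _ _ JJ').
Qed.

HB.instance Definition _ := GRing.isSubmodClosed.Build R {ffun jidx -> R}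
  jet_sym jet_sym_submod_closed.

Record jet := Jet { jetval :> {ffun jidx -> R}; _ : jetval \in jet_sym }.

HB.instance Definition _ := [isSub for jetval].
HB.instance Definition _ := [Choice of jet by <:].
HB.instance Definition _ := [SubChoice_isSubLmodule of jet by <:].

Definition jdot (X Y : jet) : R := \sum_(a : jidx) X a * Y a.

Definition jnorm (X : jet) : R := Num.sqrt (jdot X X).

Lemma jet0 a : (0 : jet) a = 0.
Proof. by rewrite -[jetval _]/(val _) raddf0 ffunE. Qed.

Lemma jetD (X Y : jet) a : (X + Y) a = X a + Y a.
Proof. by rewrite -[jetval _]/(val _) raddfD ffunE. Qed.

Lemma jetZ t (X : jet) a : (t *: X) a = t * X a.
Proof. by rewrite -[jetval _]/(val _) linearZ ffunE. Qed.

Lemma jdot_ge0 X : 0 <= jdot X X.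
Proof. by apply: sumr_ge0 => a _; rewrite -expr2 sqr_ge0. Qed.

Lemma jdotDl X Y Z : jdot (X + Y) Z = jdot X Z + jdot Y Z.
Proof.
by rewrite /jdot -big_split; apply: eq_bigr => a _; rewrite jetD mulrDl.
Qed.

Lemma jdotC X Y : jdot X Y = jdot Y X.
Proof. by apply: eq_bigr => a _; rewrite mulrC. Qed.

Lemma jdotZl t X Y : jdot (t *: X) Y = t * jdot X Y.
Proof.
by rewrite /jdot mulr_sumr; apply: eq_bigr => a _; rewrite jetZ mulrA.
Qed.

Lemma jdotDr X Y Z : jdot X (Y + Z) = jdot X Y + jdot X Z.
Proof. by rewrite jdotC jdotDl !(jdotC X). Qed.

Lemma jdotZr t X Y : jdot X (t *: Y) = t * jdot X Y.
Proof. by rewrite jdotC jdotZl jdotC. Qed.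

Lemma jdot_eq0 X : jdot X X = 0 -> X = 0.
Proof.
move=> /eqP; rewrite psumr_eq0; last by move=> a _; rewrite -expr2 sqr_ge0.
move=> /allP X0; apply/val_inj/ffunP => a; rewrite linear0 ffunE.
by have := X0 a (mem_index_enum _); rewrite /= mulf_eq0 orbb => /eqP.
Qed.

Lemma CauchySchwarz_jdot X Y : jdot X Y <= jnorm X * jnorm Y.
Proof.
have [/jdot_eq0 ->|Y0] := eqVneq (jdot Y Y) 0.
  by rewrite -(scale0r (0 : jet)) jdotZr mul0r mulr_ge0 ?sqrtr_ge0.
have Ygt0 : 0 < jdot Y Y by rewrite lt_def Y0 jdot_ge0.
have [XY|/ltW XY] := lerP (jdot X Y) 0.
  by rewrite (le_trans XY)// mulr_ge0 ?sqrtr_ge0.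
rewrite -(ler_pXn2r (ltn0Sn 1)) ?nnegrE ?mulr_ge0 ?sqrtr_ge0//.
rewrite exprMn !sqr_sqrtr ?jdot_ge0//.
pose c := jdot X Y / jdot Y Y.
have := jdot_ge0 (X + (- c) *: Y).
rewrite jdotDl !jdotDr !jdotZl !jdotZr (jdotC Y X).
have -> : jdot X X + - c * jdot X Y +
    (- c * jdot X Y + - c * (- c * jdot Y Y)) =
    jdot X X - jdot X Y ^+ 2 / jdot Y Y by rewrite /c; field.
by rewrite subr_ge0 ler_pdivrMr.
Qed.

Lemma ler_jnormD X Y : jnorm (X + Y) <= jnorm X + jnorm Y.
Proof.
rewrite -(ler_pXn2r (ltn0Sn 1)) ?nnegrE ?addr_ge0 ?sqrtr_ge0//.
rewrite sqrrD !sqr_sqrtr ?jdot_ge0// jdotDl !jdotDr (jdotC Y X).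
have := CauchySchwarz_jdot X Y; lra.
Qed.

Lemma jnormZ t X : jnorm (t *: X) = `|t| * jnorm X.
Proof.
rewrite /jnorm jdotZl jdotZr mulrA -expr2 sqrtrM ?sqr_ge0//.
by rewrite sqrtr_sqr.
Qed.

Lemma jnorm_eq0 X : jnorm X = 0 -> X = 0.
Proof.
move=> /eqP; rewrite sqrtr_eq0 => X0; apply: jdot_eq0.
by apply/eqP; rewrite eq_le X0 jdot_ge0.
Qed.

HB.instance Definition _ := Lmodule_isNormed.Build R jet
  ler_jnormD jnormZ jnorm_eq0.

(* Riesz representation: [sym_delta a] is the orthogonal projection onto the
   symmetric tensors of the a-th vector of the canonical basis. *)
Lemma sym_delta_sym (a : jidx) : [ffun b : jidx =>
  if (b.1 == a.1) && perm_eq b.2 a.2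
  then #|[pred J : k.-bseq 'I_n | perm_eq J a.2]|%:R^-1 : R else 0]
  \in jet_sym.
Proof.
by apply/jet_symP => i J J' JJ'; rewrite !ffunE/= (permPl JJ').
Qed.

Definition sym_delta (a : jidx) : jet := Jet (sym_delta_sym a).

Lemma jet_decomp (Y : jet) : Y = \sum_(a : jidx) Y a *: sym_delta a.
Proof.
apply/val_inj/ffunP => -[i J]; rewrite linear_sum/= sum_ffunE.
rewrite (eq_bigr (fun a => Y a * sym_delta a (i, J))); last first.
  by move=> a _; rewrite !ffunE.
have sY : val Y \in jet_sym by case: (Y).
rewrite (bigID [pred a : jidx | (i == a.1) && perm_eq J a.2])/=.
rewrite [X in _ = _ + X]big1 ?addr0; last first.
  by move=> a /negbTE ia; rewrite ffunE/= ia mulr0.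
set c : R := #|[pred J' : k.-bseq 'I_n | perm_eq J' J]|%:R.
rewrite (eq_bigr (fun=> Y (i, J) / c)); last first.
  move=> -[i' J'] /=/andP[/eqP <- JJ']; rewrite ffunE/= eqxx JJ'/=.
  rewrite -(jet_symP _ sY i J J' JJ') /c; congr (_ / _%:R).
  by apply: eq_card => J0; rewrite !inE (permPr JJ').
rewrite sumr_const (_ : #|_| = #|[pred J' : k.-bseq 'I_n | perm_eq J' J]|).
  rewrite -[in RHS]mulr_natr -/c divfK// pnatr_eq0 -lt0n.
  by apply/card_gt0P; exists J; exact: perm_refl.
rewrite -[RHS](card_imset _ (fun J1 J2 (e : (i, J1) = (i, J2)) => congr1 snd e)).
apply: eq_card => -[i' J']; apply/idP/imsetP => /=.
  by move=> /andP[/= /eqP <- JJ']; exists J'; rewrite // inE perm_sym.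
by move=> [J0]; rewrite inE perm_sym => JJ0 [-> ->]; rewrite unfold_in/= eqxx.
Qed.

Lemma jet_riesz (f : {linear jet -> R}) : exists G, forall Y, f Y = jdot G Y.
Proof.
have sG : [ffun a : jidx => f (sym_delta a)] \in jet_sym.
  apply/jet_symP => i J J' JJ'; rewrite !ffunE; congr (f _).
  apply/val_inj/ffunP => -[i' J0]; rewrite !ffunE/= (permPr JJ').
  congr (if _ then _%:R^-1 else _).
  by apply: eq_card => J1; rewrite !inE (permPr JJ').
exists (Jet sG) => Y; rewrite {1}(jet_decomp Y) linear_sum.
by apply: eq_bigr => a _; rewrite linearZ ffunE mulrC.
Qed.

(* The Riesz representative of the Fréchet derivative, see [gradientE]. *)
Definition gradient (h : jet -> R) (X : jet) : jet :=
  get [set G : jet | forall Y, 'd h X Y = jdot G Y].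

Lemma gradientE (h : jet -> R) X Y : 'd h X Y = jdot (gradient h X) Y.
Proof.
have [G GP] := jet_riesz ('d h X).
exact: (@getPex _ [set G : jet | forall Y, 'd h X Y = jdot G Y] (ex_intro _ G GP)).
Qed.

Definition is_C1 (h : jet -> R) :=
  (forall X, differentiable h X) /\ continuous (gradient h).

End jets.
Arguments jet : clear implicits.

(* Points outside of A, where the value is -oo, do not contribute. *)
Definition ess_sup_on {R : realType} {n : nat} (A : set 'rV[R]_n)
    (f : 'rV[R]_n -> R) : \bar R :=
  ess_sup (leb R n) (patch (fun=> -oo%E) A (EFin \o f) : lebT R n -> \bar R).

Lemma ess_sup_onP {R : realType} {n : nat} (A : set 'rV[R]_n)
    (f : 'rV[R]_n -> R) (y : \bar R) :
  (ess_sup_on A f <= y)%E <-> {ae leb R n, forall x : lebT R n, A x -> ((f x)%:E <= y)%E}.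
Proof.
split=> [/ess_supP|H].
  by apply: filterS => x /=; rewrite /patch => + Ax; rewrite mem_set.
apply/ess_supP; apply: filterS H => x /= H; rewrite /patch.
by case: ifPn => [/set_mem/H//|_]; rewrite leNye.
Qed.

Lemma ess_sup_on_lty {R : realType} {n : nat} (A : set 'rV[R]_n)
    (f : 'rV[R]_n -> R) :
  (ess_sup_on A f < +oo)%E <->
  exists M : R, {ae leb R n, forall x : lebT R n, A x -> f x <= M}.
Proof.
split=> [|[M fM]]; last first.
  apply: (@le_lt_trans _ _ M%:E); rewrite ?ltry//; apply/ess_sup_onP.
  by apply: filterS fM => x /= fM /fM; rewrite lee_fin.
case E : (ess_sup_on A f) => [M| |]// _; [exists M|exists 0].
- have /ess_sup_onP : (ess_sup_on A f <= M%:E)%E by rewrite E.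
  by apply: filterS => x /= H /H; rewrite lee_fin.
- have /ess_sup_onP : (ess_sup_on A f <= 0%:E)%E by rewrite E leNye.
  by apply: filterS => x /= H /H; rewrite lee_fin.
Qed.

Section sobolev.
Context {R : realType}.

(* partials [:: i_1; ...; i_j] f = d_{i_1} ... d_{i_j} f. *)
Definition partials {n} (J : seq 'I_n) (f : 'rV[R]_n -> R) : 'rV[R]_n -> R :=
  foldr (fun i g x => 'D_(delta_mx ord0 i) g x) f J.

Definition test_function {n} (Omega : set 'rV[R]_n) (psi : 'rV[R]_n -> R) :=
  (forall J : seq 'I_n, continuous (partials J psi) /\
     forall i x, derivable (partials J psi) x (delta_mx ord0 i)) /\
  exists K : set 'rV[R]_n, [/\ compact K, K `<=` Omega &
     forall x, ~ K x -> psi x = 0].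

(* For every i and every j <= k, the functions U_{i, i_1 ... i_j} are the weak
   derivatives d_{i_1} ... d_{i_j} U_i of the zeroth order component U_i. Test
   functions vanish outside of Omega, so that integrals over R^n are integrals
   over Omega. The integrability conditions, which give a meaning to the integrals, are
   automatic when U is measurable and essentially bounded on an open Omega. *)
Definition weak_jet {N n k} (Omega : set 'rV[R]_n)
    (U : 'rV[R]_n -> jet R N n k) :=
  forall psi, test_function Omega psi -> forall i (J : k.-bseq 'I_n),
  [/\ (leb R n).-integrable setT
         (fun x => (U x (i, [bseq]) * partials J psi x)%:E),
      (leb R n).-integrable setT (fun x => (U x (i, J) * psi x)%:E) &
      \int[leb R n]_x (U x (i, [bseq]) * partials J psi x) =
      (-1) ^+ size J * \int[leb R n]_x (U x (i, J) * psi x)].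

Definition Wkinf_pred N {n} k (Omega : set 'rV[R]_n) :
    {pred 'rV[R]_n -> jet R N n k} :=
  [pred U : 'rV[R]_n -> jet R N n k | `[< [/\
    forall a, measurable_fun (Omega : set (lebT R n)) (fun x : lebT R n => U x a),
    (ess_sup_on Omega (fun x => `|U x|%R) < +oo)%E &
    weak_jet Omega U] >] ].

Let integrable_lin {n} (f g : lebT R n -> R) (t : R) :
  (leb R n).-integrable setT (fun x => (f x)%:E) ->
  (leb R n).-integrable setT (fun x => (g x)%:E) ->
  (leb R n).-integrable setT (fun x => (t * f x + g x)%:E) /\
  \int[leb R n]_x (t * f x + g x) =
  t * \int[leb R n]_x f x + \int[leb R n]_x g x.
Proof.
move=> fi gi.
have tfi : (leb R n).-integrable setT (fun x => (t * f x)%:E).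
  by apply: (eq_integrable measurableT _ _ _ (integrableZl measurableT t fi)).
split; last by rewrite RintegralD// RintegralZl.
by apply: (eq_integrable measurableT _ _ _ (integrableD measurableT tfi gi)).
Qed.

Lemma Wkinf_submod_closed N n k (Omega : set 'rV[R]_n) :
  submod_closed (@Wkinf_pred N n k Omega).
Proof.
split=> [|t U V /asboolP[mU bU wU] /asboolP[mV bV wV]]; apply/asboolP; split.
- move=> a; rewrite (_ : (fun _ => _) = cst 0); first exact: measurable_cst.
  by apply/funext => x; exact: jet0.
- apply/ess_sup_on_lty; exists 0; apply: nearW => x _.
  by rewrite -[_ x]/(0 : jet R N n k) normr0.
- move=> psi _ i J.
  have E c (g : 'rV[R]_n -> R) :
      (fun x : lebT R n => (0 : 'rV[R]_n -> jet R N n k) x c * g x) = cst 0.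
    by apply/funext => x; rewrite -[_ x]/(0 : jet R N n k) jet0 mul0r.
  have i0 : (leb R n).-integrable setT (fun=> 0%:E) by exact: integrable0.
  split.
  + by move: i0; congr integrable; apply/funext => x; have /funeqP := E
      (i, [bseq]) (partials J psi); move=> ->.
  + by move: i0; congr integrable; apply/funext => x; have /funeqP := E
      (i, J) psi; move=> ->.
  + by rewrite !E /Rintegral !integral0 mulr0.
- move=> a; rewrite (_ : (fun _ => _) = (fun x => t * U x a) \+ (fun x => V x a)).
    by apply: measurable_funD => //; apply: measurable_funM => //.
  by apply/funext => x; rewrite -[(_ + _) x]/(t *: U x + V x) jetD jetZ.
- have /ess_sup_on_lty[M UM] := bU; have /ess_sup_on_lty[M' VM'] := bV.
  apply/ess_sup_on_lty; exists (`|t| * M + M').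
  apply: filterS2 UM VM' => x /= UM VM' Ox.
  rewrite -[(_ + _) x]/(t *: U x + V x) (le_trans (ler_normD _ _))// normrZ lerD ?VM'//.
  by rewrite ler_wpM2l ?UM.
- move=> psi tpsi i J.
  have [iU iU' eU] := wU _ tpsi i J; have [iV iV' eV] := wV _ tpsi i J.
  have E c (g : 'rV[R]_n -> R) x :
      (t *: U + V) x c * g x = t * (U x c * g x) + V x c * g x.
    by rewrite -[(_ + _) x]/(t *: U x + V x) jetD jetZ; ring.
  have [i1 e1] := integrable_lin t iU iV.
  have [i2 e2] := integrable_lin t iU' iV'.
  split.
  + by apply: (eq_integrable measurableT _ _ _ i1) => x _; rewrite E.
  + by apply: (eq_integrable measurableT _ _ _ i2) => x _; rewrite E.
  + under eq_Rintegral do rewrite E.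
    under [in RHS]eq_Rintegral do rewrite E.
    by rewrite e1 e2 eU eV; ring.
Qed.

HB.instance Definition _ N n k (Omega : set 'rV[R]_n) :=
  GRing.isSubmodClosed.Build R ('rV[R]_n -> jet R N n k)
    (@Wkinf_pred N n k Omega) (Wkinf_submod_closed N k Omega).

(* An element of W^(k,oo)(Omega; R^N) is represented by its k-jet
   D^k u = (u, Du, ..., D^k u), whose components are determined by the first
   one up to equality a.e. in Omega; values outside of Omega are irrelevant. *)
Record Wkinf N {n} k (Omega : set 'rV[R]_n) := MkWkinf {
  Djet :> 'rV[R]_n -> jet R N n k ;
  _ : Djet \in @Wkinf_pred N n k Omega }.

HB.instance Definition _ N n k (Omega : set 'rV[R]_n) :=
  [isSub for @Djet N n k Omega].
HB.instance Definition _ N n k (Omega : set 'rV[R]_n) :=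
  [Choice of Wkinf N k Omega by <:].
HB.instance Definition _ N n k (Omega : set 'rV[R]_n) :=
  [SubChoice_isSubLmodule of Wkinf N k Omega by <:].

End sobolev.

Section functional.
Context {R : realType}.

Definition Einf {N n k} {Omega : set 'rV[R]_n}
    (H : 'rV[R]_n -> jet R N n k -> R) (u : Wkinf N k Omega)
    (O : set 'rV[R]_n) : \bar R :=
  ess_sup_on O (fun x => H x (u x)).

Definition caratheodory_fun {N n k} (Omega : set 'rV[R]_n)
    (H : 'rV[R]_n -> jet R N n k -> R) :=
  (forall X, measurable_fun (Omega : set (lebT R n)) (H ^~ X : lebT R n -> R)) /\
  {ae leb R n, forall x : lebT R n, Omega x -> continuous (H x)}.

(* Only the values on ]0, +oo[ are constrained. In [ess_uniformly_C1] the case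
   X'' = X' merely amounts to 0 <= omega 0. *)
Definition modulus_of_continuity (omega : R -> R) :=
  [/\ {in `]0, +oo[ &, {homo omega : s t / s <= t}},
      {in `]0, +oo[, continuous omega} &
      omega s @[s --> 0^'+] --> 0].

Definition ess_uniformly_C1 {N n k} (Omega : set 'rV[R]_n)
    (H : 'rV[R]_n -> jet R N n k -> R) :=
  {ae leb R n, forall x : lebT R n, Omega x -> is_C1 (H x)} /\
  forall r : R, 0 < r -> exists omega : R -> R, modulus_of_continuity omega /\
    forall X'' X' : jet R N n k, ball 0 r X'' -> ball 0 r X' ->
      (ess_sup_on Omega (fun x => `|H x X'' - H x X'|%R) <=
         (omega `|X'' - X'|)%:E)%E /\
      (ess_sup_on Omega
         (fun x => `|gradient (H x) X'' - gradient (H x) X'|%R) <=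
         (omega `|X'' - X'|)%:E)%E.

(* Functionals take values in \bar R because essential suprema do;
   semi-differentiability asks for a finite limit. *)
Definition diff_quotient {V : lmodType R} (f : V -> \bar R) (u phi : V) (t : R) :
    \bar R :=
  ((f (u + t *: phi)%R - f u) * (t^-1)%R%:E)%E.

Definition semi_differentiable {V : lmodType R} (f : V -> \bar R) (u : V) :=
  forall phi, exists l : R, diff_quotient f u phi t @[t --> 0^'+] --> l%:E.

Definition right_semiderivative {V : lmodType R} (f : V -> \bar R)
    (u phi : V) : \bar R :=
  lim (diff_quotient f u phi t @[t --> 0^'+]).

End functional.

(* Main.v *)
(* Write f_t = H(., D^k(u + t phi)) and g = H_X(., D^k u) : D^k phi. The uniform
   C^1 bounds and the mean value theorem give |f_t - f_0 - t g| <= t eta(t) a.e.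
   with eta(0+) = 0. The rest is a Danskin-type argument. With E_t = ess sup f_t
   and L(eps) = ess sup of g over {f_0 >= E_0 - eps}, testing f_t on a non-null
   subset of {f_0 >= E_0 - t d} where g is almost L(t d) bounds (E_t - E_0)/t from
   below by inf L - eta(t); conversely, once t is small compared to eps the set
   {f_0 < E_0 - eps} does not matter, and (E_t - E_0)/t <= L(eps) + eta(t). *)
Require Import Defs.
From mathcomp Require Import all_boot all_order all_algebra.
From mathcomp Require Import all_classical all_reals all_analysis.
From mathcomp Require Import measurable_realfun lra.
Import Order.TTheory GRing.Theory Num.Theory.
Import numFieldNormedType.Exports.
Set Implicit Arguments.
Unset Strict Implicit.
Unset Printing Implicit Defensive.
Local Open Scope classical_set_scope.
Local Open Scope ring_scope.

(** * Lebesgue outer measure of boxes and of open sets *)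

Lemma lebesgue_measure_ccitv (R : realType) (a b : R) :
  lebesgue_measure `[a, b]%classic = (Num.max 0 (b - a))%:E.
Proof.
rewrite lebesgue_measure_itv/= lte_fin; have [ab|ba] := ltP a b.
  by rewrite -EFinB max_r// subr_ge0 ltW.
by rewrite max_l// subr_le0.
Qed.

(** Integrating the pointwise bound over [D] and exchanging sum and integral turns each indicator
    into the measure of the intersection of [D] and [B j], which is at most [mu (B j)]. *)
Lemma integral_cover d (T : measurableType d) (R : realType)
    (mu : {measure set T -> \bar R}) (D : set T) (B : nat -> set T)
    (K : R) (p : nat -> R) :
  measurable D -> 0 <= K -> (forall j, 0 <= p j) ->
  (forall j, measurable (B j)) ->
  (forall y, D y -> (K%:E <= \sum_(j <oo) ((p j)%:E * (\1_(B j) y)%:E))%E) ->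
  (K%:E * mu D <= \sum_(j <oo) ((p j)%:E * mu (B j)))%E.
Proof.
move=> mD K0 p0 mB cov.
have mI j : measurable_fun D (fun y => (\1_(B j) y : R)%:E).
  exact/measurable_EFinP/measurable_indic.
have mE j : measurable_fun D (fun y => ((p j)%:E * (\1_(B j) y)%:E)%E).
  exact: measurable_funeM.
have E0 j y : (0 <= (p j)%:E * (\1_(B j) y)%:E)%E.
  by rewrite -EFinM lee_fin mulr_ge0// indicE.
rewrite -integral_cst//; apply: (@le_trans _ _ (\int[mu]_(y in D) (\sum_(j <oo)
    ((p j)%:E * (\1_(B j) y)%:E)))%E).
  apply: ge0_le_integral => //.
  by apply: (@ge0_emeasurable_sum _ _ _ _ _ xpredT) => [k y _ _|k _].
rewrite integral_nneseries//; apply: lee_nneseries => [j _ _|j _].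
  by apply: integral_ge0.
rewrite ge0_integralZl//; last by rewrite lee_fin.
rewrite integral_indic//; apply: lee_wpmul2l; first by rewrite lee_fin.
by apply: le_measure; rewrite ?inE//; exact: measurableI.
Qed.

(* Fubini in disguise: integrating the covering inequality over the last
   coordinate turns the last indicator into a length. *)
Lemma prod_cover (R : realType) (n : nat) (w : nat -> R)
    (c d : nat -> nat -> R) (a b : nat -> R) (K : R) :
  0 <= K -> (forall j, 0 <= w j) -> (forall i, a i <= b i) ->
  (forall x : nat -> R, (forall i, a i <= x i <= b i) ->
     (K%:E <= \sum_(j <oo)
        (w j * \prod_(i < n) \1_(`[c j i, d j i]%classic) (x i))%:E)%E) ->
  ((K * \prod_(i < n) (b i - a i))%:E <=
     \sum_(j <oo) (w j * \prod_(i < n) Num.max 0 (d j i - c j i))%:E)%E.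
Proof.
elim: n w K => [|n IH] w K K0 w0 ab cov.
  have prod0 F : (\sum_(j <oo) (w j * \prod_(i < 0) F j i)%:E)%E =
      (\sum_(j <oo) (w j)%:E)%E.
    by apply: eq_eseriesr => j _; rewrite big_ord0 mulr1.
  have := cov a; rewrite big_ord0 mulr1 !prod0.
  by apply => i; rewrite lexx ab.
(* For the induction, the last side of the covered box is absorbed into [K], and the last sides of
   the covering boxes into the weights. *)
rewrite big_ord_recr/= mulrA mulrAC.
rewrite (eq_eseriesr (g := fun j => (w j * Num.max 0 (d j n - c j n) *
    \prod_(i < n) Num.max 0 (d j i - c j i))%:E)); last first.
  by move=> j _; rewrite big_ord_recr/= mulrA mulrAC.
apply: IH => //.
- by rewrite mulr_ge0// subr_ge0.
- by move=> j; rewrite mulr_ge0// le_max lexx.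
move=> x xab; pose D := `[a n, b n]%classic.
pose p j := w j * \prod_(i < n) \1_(`[c j i, d j i]%classic) (x i).
have p0 j : 0 <= p j.
  by rewrite mulr_ge0// prodr_ge0// => i _; rewrite indicE.
have slice y : D y -> (K%:E <= \sum_(j <oo)
    ((p j)%:E * (\1_(`[c j n, d j n]%classic) y)%:E))%E.
  rewrite /D /= in_itv/= => yab.
  (* Coordinates are indexed by [nat], so moving along the last axis only changes the value of [x]
     at [n]. *)
  have /cov : forall i, a i <= (if i == n then y else x i) <= b i.
    by move=> i; case: eqP => [->|].
  congr (_ <= _)%E; apply: eq_eseriesr => j _.
  rewrite big_ord_recr/= eqxx -EFinM /p mulrA; congr (_ * _ * _)%:E.
  by apply: eq_bigr => i _; rewrite ltn_eqF.
have := integral_cover lebesgue_measure (measurable_itv _) K0 p0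
  (fun j => measurable_itv _) slice.
rewrite [X in (_ * X)%E](lebesgue_measure_ccitv (a n)) max_r ?subr_ge0//.
rewrite -EFinM => /le_trans; apply; apply: lee_nneseries => [j _ _|j _].
  by apply: mule_ge0 => //; rewrite lee_fin.
rewrite [X in (_ * X)%E](lebesgue_measure_ccitv (c j n)) -EFinM lee_fin.
by rewrite /p mulrAC.
Qed.

(** The outer measure is even at least the volume: every countable cover by boxes satisfies the
    hypothesis of [prod_cover] with [K = 1]. *)
Lemma lebesgue_outer_box_gt0 (R : realType) (n : nat) (a b : 'rV[R]_n) :
  (forall i, a ord0 i < b ord0 i) -> (0 < lebesgue_outer (box (a, b)))%E.
Proof.
move=> ab.
have vab : 0 < box_vol (a, b).
  by apply: prodr_gt0 => i _; rewrite lt_max subr_gt0 ab orbT.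
apply: (@lt_le_trans _ _ (box_vol (a, b))%:E); first by rewrite lte_fin.
apply: le_ereal_inf_tmp => _ [F FB <-].
(* [prod_cover] takes coordinates indexed by [nat], so vectors are extended by 0. The weight 0 in
   [w] discards the members [None] of the cover. *)
pose co (v : 'rV[R]_n) (i : nat) : R := oapp (v ord0) 0 (insub i).
have coE (v : 'rV[R]_n) (i : 'I_n) : co v i = v ord0 i by rewrite /co valK.
pose w j : R := if F j is Some _ then 1 else 0.
pose c j := co (odflt (0, 0) (F j)).1; pose d j := co (odflt (0, 0) (F j)).2.
have coab i : co a i <= co b i.
  by rewrite /co; case: insub => //= i'; exact/ltW.
have := @prod_cover R n w c d (co a) (co b) 1 ler01.
have -> : (1 * \prod_(i < n) (co b i - co a i)) = box_vol (a, b).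
  rewrite mul1r; apply: eq_bigr => i _; rewrite !coE max_r//.
  by rewrite subr_ge0 ltW.
have -> : (\sum_(j <oo) (w j * \prod_(i < n) Num.max 0 (d j i - c j i))%:E)%E =
    (\sum_(j <oo) ovol (F j))%E.
  apply: eq_eseriesr => j _; rewrite /w /d /c /ovol.
  case: (F j) => [e|] /=; last by rewrite mul0r.
  by rewrite mul1r; congr EFin; apply: eq_bigr => i _; rewrite !coE.
apply => //; first by move=> j; rewrite /w; case: (F j).
move=> x xab; have : box (a, b) (\row_i x i).
  by move=> i /=; rewrite mxE -!coE.
(* A single box containing the point contributes a term equal to 1; all other terms are
   nonnegative. *)
move=> /FB[j _]; case Fj : (F j) => [e|]//= xe.
have T0 m : (0 <= (w m * \prod_(i < n) \1_(`[c m i, d m i]%classic) (x i))%:E)%E.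
  rewrite lee_fin mulr_ge0//; first by rewrite /w; case: (F m).
  by apply: prodr_ge0 => i _; rewrite indicE.
rewrite (nneseries_split 0 j.+1)// add0n big_nat_recr//=.
apply: (@le_trans _ _ (w j * \prod_(i < n) \1_(`[c j i, d j i]%classic) (x i))%:E);
  last first.
  rewrite -[leLHS]adde0; apply: leeD; last exact: nneseries_ge0.
  by rewrite leeDr// sume_ge0.
rewrite lee_fin /w Fj mul1r.
rewrite big1// => i _; rewrite indicE mem_set//= in_itv/= /c /d Fj/= !coE.
by have := xe i; rewrite mxE.
Qed.

(** A nonempty open set contains a nondegenerate box. This keeps the essential supremum over it from
    being -oo. *)
Lemma open_not_negligible (R : realType) (n : nat) (Omega : set 'rV[R]_n) :
  open Omega -> Omega !=set0 -> ~ (leb R n).-negligible Omega.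
Proof.
move=> oO [x Ox] [A [mA A0 OA]].
have /nbhs_ballP[e /= e0 xeO] : nbhs x Omega by exact: open_nbhs_nbhs.
suff : (lebesgue_outer (box (x, (\row_i (x ord0 i + e / 2))%R)) <= leb R n A)%E.
  rewrite A0 leNgt lebesgue_outer_box_gt0// => i.
  by rewrite mxE ltrDl divr_gt0.
apply: le_lebesgue_outer => y xy; apply/OA/xeO.
split=> // i j; rewrite (ord1 i) /ball/=.
have := xy j; rewrite /= mxE => /andP[]; rewrite ltr_norml; lra.
Qed.

(** * Finite essential suprema and the Danskin-type derivative *)

Lemma ae_not_negligible (R : realType) (n : nat) (A : set 'rV[R]_n) :
  {ae leb R n, forall x : lebT R n, ~ A x} -> (leb R n).-negligible A.
Proof. by apply: negligibleS => x Ax /=; exact. Qed.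

Lemma ess_sup_on_fin (R : realType) (n : nat) (A : set 'rV[R]_n)
    (f : 'rV[R]_n -> R) (C : R) :
  ~ (leb R n).-negligible A ->
  {ae leb R n, forall x : lebT R n, A x -> `|f x| <= C} ->
  exists2 e : R, ess_sup_on A f = e%:E & `|e| <= C.
Proof.
move=> nA fC.
have leC : (ess_sup_on A f <= C%:E)%E.
  apply/ess_sup_onP; apply: filterS fC => x + Ax => /(_ Ax).
  by rewrite lee_fin ler_norml => /andP[].
have geC : ((- C)%:E <= ess_sup_on A f)%E.
  rewrite leNgt; apply/negP => ltC; apply/nA/ae_not_negligible.
  (* A real [y] below [- C] that still bounds [f] a.e. on [A] contradicts [- C <= f], unless [A] is
     null. *)
  have [y /andP[ey yC]] : exists y : R, (ess_sup_on A f <= y%:E)%E && (y < - C).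
    case: (ess_sup_on A f) ltC => [y| |]//=.
      by rewrite lte_fin => yC; exists y; rewrite lexx.
    by move=> _; exists (- C - 1); rewrite leNye gtrBl ltr01.
  move/ess_sup_onP : ey => ey; apply: filterS2 ey fC => x ey fC Ax.
  have := fC Ax; have := ey Ax; rewrite lee_fin ler_norml => fy /andP[Cf _].
  by have := lt_le_trans yC (le_trans Cf fy); rewrite ltxx.
case E : (ess_sup_on A f) leC geC => [y| |]// ? ?.
by exists y => //; rewrite ler_norml; apply/andP.
Qed.

Lemma ess_sup_on_EFinP (R : realType) (n : nat) (A : set 'rV[R]_n)
    (f : 'rV[R]_n -> R) (e y : R) : ess_sup_on A f = e%:E ->
  e <= y <-> {ae leb R n, forall x : lebT R n, A x -> f x <= y}.
Proof. by move=> E; rewrite -lee_fin -E; exact: ess_sup_onP. Qed.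

(** Jets do not appear here: a first-order expansion with uniform remainder suffices. The common
    limit is the infimum over [eps] of the essential suprema of [g] on the level sets. *)
Lemma danskin_ess_sup (R : realType) (n : nat) (A : set 'rV[R]_n)
    (f : R -> 'rV[R]_n -> R) (g : 'rV[R]_n -> R) (eta : R -> R) (C G : R) :
  ~ (leb R n).-negligible A ->
  eta t @[t --> 0^'+] --> 0 ->
  {ae leb R n, forall x : lebT R n, A x -> `|f 0 x| <= C} ->
  {ae leb R n, forall x : lebT R n, A x -> `|g x| <= G} ->
  {ae leb R n, forall x : lebT R n, A x ->
    forall t, 0 < t < 1 -> `|f t x - f 0 x - t * g x| <= t * eta t} ->
  exists l : R,
    ess_sup_on [set x | A x /\ (ess_sup_on A (f 0%R) - eps%:E <= (f 0%R x)%:E)%E] g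
      @[eps --> 0^'+] --> l%:E /\
    ((ess_sup_on A (f t) - ess_sup_on A (f 0%R)) * (t^-1)%:E)%E @[t --> 0^'+]
      --> l%:E.
Proof.
move=> A_not_negligible eta0 f0C gG expand.
pose level eps : set 'rV[R]_n :=
  [set x | A x /\ (ess_sup_on A (f 0%R) - eps%:E <= (f 0%R x)%:E)%E].
have [e0 E0 _] := ess_sup_on_fin A_not_negligible f0C.
have levelP eps x : level eps x <-> A x /\ e0 - eps <= f 0 x.
  by rewrite /level/= E0 -EFinB lee_fin.
have level_nn eps : 0 < eps -> ~ (leb R n).-negligible (level eps).
  move=> eps0 neg.
  (* Were the level set null, [e0 - eps] would already bound [f 0] a.e. on [A]. *)
  suff : e0 <= e0 - eps by lra.
  apply/(ess_sup_on_EFinP _ E0).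
  have : {ae leb R n, forall x : lebT R n, ~ level eps x}.
    by apply: negligibleS neg => x /= /contrapT.
  apply: filterS => x /levelP nlev Ax; rewrite leNgt; apply/negP => /ltW ?.
  exact: nlev.
have [l Ll] : exists l : R -> R, forall eps, 0 < eps ->
    ess_sup_on (level eps) g = (l eps)%:E /\ `|l eps| <= G.
  exists (fun eps => fine (ess_sup_on (level eps) g)) => eps eps0.
  have [|le -> //] := @ess_sup_on_fin R n (level eps) g G (level_nn _ eps0).
  by apply: filterS gG => x gx /levelP[Ax _]; exact: gx.
have [e Ee] : exists e : R -> R, forall t, 0 < t < 1 ->
    ess_sup_on A (f t) = (e t)%:E.
  exists (fun t => fine (ess_sup_on A (f t))) => t t01.
  have [|et -> //] := @ess_sup_on_fin R n A (f t) (C + t * G + t * eta t)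
    A_not_negligible.
  apply: filterS3 f0C gG expand => x fx gx ex Ax.
  have := ex Ax t t01; have := fx Ax; have := gx Ax.
  rewrite !ler_norml => /andP[? ?] /andP[? ?] /andP[? ?].
  have t0 : 0 < t by case/andP: t01.
  have : t * g x <= t * G by rewrite ler_pM2l.
  have : t * - G <= t * g x by rewrite ler_pM2l.
  by move=> ? ?; apply/andP; split; lra.
(* Level sets grow with [eps], so [l] is monotone and its right limit at 0 is its infimum [l0]. *)
have l_homo s t : 0 < s -> s <= t -> l s <= l t.
  move=> s0 st; have t0 := lt_le_trans s0 st.
  apply/(ess_sup_on_EFinP _ (Ll _ s0).1).
  have /(ess_sup_on_EFinP _ (Ll _ t0).1) := lexx (l t).
  apply: filterS => x gx /levelP[Ax fx]; apply: gx; apply/levelP; split=> //.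
  lra.
pose S := [set l eps | eps in [set eps | 0 < eps]].
have S_inf : has_inf S.
  split; first by exists (l 1); exists 1 => /=.
  exists (- G) => _ [eps /= eps0 <-]; have [_] := Ll _ eps0.
  by rewrite ler_norml => /andP[].
pose l0 := inf S.
have l0_le eps : 0 < eps -> l0 <= l eps.
  by move=> eps0; apply: ge_inf; [exact: S_inf.2|exists eps].
have lower t : 0 < t < 1 -> l0 - eta t <= (e t - e0) / t.
  move=> t01; have t0 : 0 < t by case/andP: t01.
  (* One half of [d] pays for the depth [t * d'] of the level set; the other would leave
     [g <= l (t * d') - d'] a.e. on it, below the essential supremum. *)
  apply/ler_addgt0Pr => d d0; pose d' := d / 2.
  have d'0 : 0 < d' by rewrite divr_gt0.
  rewrite leNgt; apply/negP => ltQ.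
  have td'0 : 0 < t * d' by rewrite mulr_gt0.
  suff : l (t * d') <= l (t * d') - d' by lra.
  apply/(ess_sup_on_EFinP _ (Ll _ td'0).1).
  have /(ess_sup_on_EFinP _ (Ee _ t01)) := lexx (e t).
  move=> ft; apply: filterS2 ft expand => x ft ex /levelP[Ax fx].
  have := ex Ax t t01; rewrite ler_norml => /andP[ex' _]; have := ft Ax => ft'.
  have : l0 <= l (t * d') by exact: l0_le.
  have : (e t - e0) < t * (l0 - eta t - d).
    by rewrite mulrC -ltr_pdivrMr// ltrBrDr.
  move=> et ll; suff : t * g x <= t * (l (t * d') - d') by rewrite ler_pM2l.
  have : t * l0 <= t * l (t * d') by rewrite ler_pM2l.
  have : d = d' + d' by rewrite /d'; lra.
  move: et => /[swap] ->; rewrite !mulrBr mulrDr; lra.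
have upper t eps : 0 < t < 1 -> 0 < eps -> t * (G + G) <= eps ->
    (e t - e0) / t <= l eps + eta t.
  move=> t01 eps0 tG; have t0 : 0 < t by case/andP: t01.
  rewrite ler_pdivrMr// lerBlDl.
  apply/(ess_sup_on_EFinP _ (Ee _ t01)).
  have /(ess_sup_on_EFinP _ (Ll _ eps0).1) gl := lexx (l eps).
  have /(ess_sup_on_EFinP _ E0) fe := lexx e0.
  have [_ ] := Ll _ eps0; rewrite ler_norml => /andP[lG _].
  have {}lG : t * - G <= t * l eps by rewrite ler_pM2l.
  near=> x => Ax.
  have gl' : level eps x -> g x <= l eps by near: x.
  have fe' : f 0 x <= e0 by move: Ax; near: x.
  have /(_ t t01) : forall t, 0 < t < 1 -> `|f t x - f 0 x - t * g x| <= t * eta t.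
    by move: Ax; near: x.
  have : `|g x| <= G by move: Ax; near: x.
  rewrite !ler_norml => /andP[_ gG'] /andP[_ ft].
  have [le|lt] := leP (e0 - eps) (f 0 x).
    have : t * g x <= t * l eps by rewrite ler_pM2l// gl'//; apply/levelP.
    lra.
  (* Off the level set, [f 0] is more than [eps] below [e0]. As [t * (G + G) <= eps], this gap makes
     up for both [t * g x <= t * G] and [- (t * G) <= t * l eps]. *)
  have : t * g x <= t * G by rewrite ler_pM2l.
  lra.
exists l0; split.
  apply: (@cvg_trans _ ((l eps)%:E @[eps --> 0^'+])).
    by apply: near_eq_cvg; near=> eps; rewrite (Ll eps _).1.
  apply: cvg_EFin; first exact: nearW.
  apply/cvgrPdist_le => d d0 /=.
  (* By monotonicity, [l eps] stays between [l0] and [l eps1] once [eps <= eps1]. *)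
  have [_ [eps1 /= eps10 <-] leps1] := inf_adherent d0 S_inf.
  near=> eps.
  have eps0 : 0 < eps by [].
  have : l eps <= l eps1 by apply: l_homo => //; near: eps; exact: nbhs_right_le.
  have := l0_le _ eps0; rewrite distrC ler_norml -/l0 in leps1 *.
  by move=> ? ?; apply/andP; split; lra.
apply: (@cvg_trans _ (((e t - e0) / t)%:E @[t --> 0^'+])).
  apply: near_eq_cvg; near=> t.
  have t01 : 0 < t < 1 by apply/andP; split.
  by rewrite E0 Ee// -EFinB -EFinM.
apply: cvg_EFin; first exact: nearW.
apply/cvgrPdist_le => d d0 /=.
have d2 : 0 < d / 2 by rewrite divr_gt0.
have [_ [eps1 /= eps10 <-] leps1] := inf_adherent d2 S_inf.
have G0 : 0 <= G by rewrite (le_trans _ (Ll _ eps10).2).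
(* The added 1 keeps the divisor positive when [G = 0]. *)
have G1 : 0 < G + G + 1 by lra.
near=> t.
have t01 : 0 < t < 1 by apply/andP; split.
have tG : t * (G + G) <= eps1.
  apply: (@le_trans _ _ (t * (G + G + 1))).
    by rewrite ler_wpM2l ?lerDl// ltW//; case/andP: t01.
  rewrite -ler_pdivlMr//.
  by near: t; apply: nbhs_right_le; rewrite divr_gt0.
have : `|0 - eta t| <= d / 2 by near: t; move/cvgrPdist_le : eta0; apply.
have := lower t t01; have := upper t eps1 t01 eps10 tG.
rewrite -/l0 in leps1; rewrite sub0r normrN distrC !ler_norml => ? ? /andP[? ?].
by apply/andP; split; lra.
Unshelve. all: by end_near. Qed.

(** * Countable reduction: rational jets *)

Lemma ae_forall_count (R : realType) (n : nat) (I : countType)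
    (P : I -> 'rV[R]_n -> Prop) :
  (forall i, {ae leb R n, forall x : lebT R n, P i x}) ->
  {ae leb R n, forall x : lebT R n, forall i, P i x}.
Proof.
(* Codes that decode to no element carry a trivial condition, which reduces the claim to sequences
   of null sets. *)
move=> aeP; pose Q m x := if unpickle m is Some i then P i x else True.
have : {ae leb R n, forall x : lebT R n, forall m, Q m x}.
  apply/ae_foralln => m; rewrite /Q; case: unpickle => [i|].
    exact: aeP.
  exact: nearW.
by apply: filterS => x Qx i; have := Qx (pickle i); rewrite /Q pickleK.
Qed.

Lemma rat_seq (R : realType) (x : R) :
  exists s : nat -> rat, (ratr (s m) : R) @[m --> \oo] --> x.
Proof.
have /choice[s sP] : forall m : nat, exists q : rat, `|x - ratr q| < m.+1%:R^-1 :> R.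
  move=> m; have m0 : 0 < m.+1%:R^-1 :> R by rewrite invr_gt0.
  have [|q] := @rat_in_itvoo R x (x + m.+1%:R^-1); first by rewrite ltrDl.
  rewrite in_itv/= => /andP[xq qx]; exists q.
  by rewrite distrC gtr0_norm ?subr_gt0// ltrBlDl.
exists s; apply/cvgrPdist_lt => e e0.
near=> m; apply: (lt_trans (sP m)); near: m.
exact: near_infty_natSinv_lt (PosNum e0).
Unshelve. all: by end_near. Qed.

Section jets.
Context {R : realType} {N n k : nat}.
Local Notation jet := (jet R N n k).
Local Notation jidx := (@jidx N n k).

(** A countable dense family. Combining the projections [sym_delta a] keeps the rational
    approximants symmetric. *)
Definition rat_jet (q : {ffun jidx -> rat}) : jet :=
  \sum_a (ratr (q a) : R) *: sym_delta a.

Lemma rat_jet_seq (X : jet) :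
  exists s : nat -> {ffun jidx -> rat}, rat_jet (s m) @[m --> \oo] --> X.
Proof.
have /choice[s sP] := fun a => rat_seq (X a).
exists (fun m => [ffun a => s a m]).
rewrite [X in _ --> X]jet_decomp /rat_jet.
under eq_fun do under eq_bigr do rewrite ffunE.
by apply: cvg_big => [|a _]; [exact: add_continuous|apply: cvgZr_tmp; exact: sP].
Qed.

(** Both sides pass to the limit along rational approximants, which eventually enter the open ball.
    [X != X'] puts the limit of the distances where [omega] is continuous. *)
Lemma rat_jet_modulus (W : normedModType R) (p : jet -> W) (omega : R -> R) (r : R) :
  continuous p -> {in `]0, +oo[, continuous omega} ->
  (forall q q', ball 0 r (rat_jet q) -> ball 0 r (rat_jet q') ->
     `|p (rat_jet q) - p (rat_jet q')| <= omega `|rat_jet q - rat_jet q'|) ->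
  forall X X', ball 0 r X -> ball 0 r X' -> X != X' ->
    `|p X - p X'| <= omega `|X - X'|.
Proof.
move=> cp comega pq X X' rX rX' XX'.
have [s sX] := rat_jet_seq X; have [s' sX'] := rat_jet_seq X'.
have cl : `|p (rat_jet (s m)) - p (rat_jet (s' m))| @[m --> \oo] --> `|p X - p X'|.
  by apply: cvg_norm; apply: cvgB; apply: continuous_cvg => //; exact: cp.
have cr : omega `|rat_jet (s m) - rat_jet (s' m)| @[m --> \oo] --> omega `|X - X'|.
  apply: continuous_cvg; last by apply: cvg_norm; exact: cvgB.
  by apply: comega; rewrite in_itv/= andbT normr_gt0 subr_eq0.
apply: ler_cvg_to cl cr _; near=> m; apply: pq; near: m.
  by apply: sX; apply: open_nbhs_nbhs; split=> //; exact: ball_open.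
by apply: sX'; apply: open_nbhs_nbhs; split=> //; exact: ball_open.
Unshelve. all: by end_near. Qed.

(** * Mean value theorem and Taylor estimate along segments of jets *)

Lemma ler_norm_jdot (X Y : jet) : `|jdot X Y| <= `|X| * `|Y|.
Proof.
rewrite ler_norml lerNl; apply/andP; split; last exact: CauchySchwarz_jdot.
rewrite -mulN1r -jdotZl -[leRHS](_ : `|(-1) *: X| * `|Y| = _).
  exact: CauchySchwarz_jdot.
by rewrite scaleN1r normrN.
Qed.

Lemma jet_MVT (h : jet -> R) (U V : jet) (t : R) : (forall X, differentiable h X) ->
  0 < t -> exists2 s, 0 < s < t &
    h (U + t *: V) - h U = t * jdot (gradient h (U + s *: V)) V.
Proof.
move=> dh t0; pose l (s : R) : jet := U + s *: V.
have dl s : is_diff s l ( *:%R^~ V).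
  rewrite -[X in is_diff _ _ X]add0r.
  exact: (is_diffD (is_diff_cst U s) (is_diff_scalel s V)).
have hl (s : R) : is_derive s 1 (h \o l) (jdot (gradient h (l s)) V).
  have dhl : differentiable (h \o l) s by apply: differentiable_comp.
  apply: DeriveDef; first exact: diff_derivable.
  rewrite deriveE// diff_comp//= -gradientE; congr ('d h _ _).
  by rewrite diff_val scale1r.
have [|s st] := @MVT R (h \o l) (fun s => jdot (gradient h (l s)) V) 0 t t0 (fun s _ => hl s).
  apply: continuous_subspaceT => s; apply: differentiable_continuous.
  by apply: differentiable_comp.
rewrite subr0 /= {2}/l scale0r addr0 mulrC => E.
by exists s => //; rewrite in_itv/= in st.
Qed.

(** The mean value theorem produces the gradient at some [U + s *: V], at distance at most [t * M]
    from [U]. That point has norm at most [M + M], hence the radius. *)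
Lemma taylor_modulus (h : jet -> R) (omega : R -> R) (M : R) (U V : jet) (t : R) :
  (forall X, differentiable h X) ->
  {in `]0, +oo[ &, {homo omega : s t / s <= t}} ->
  (forall X X', ball 0 (M + M + 1) X -> ball 0 (M + M + 1) X' -> X != X' ->
    `|gradient h X - gradient h X'| <= omega `|X - X'|) ->
  0 < M -> `|U| <= M -> `|V| <= M -> 0 < t < 1 ->
  `|h (U + t *: V) - h U - t * jdot (gradient h U) V| <= t * (M * `|omega (t * M)|).
Proof.
move=> dh homega gomega M0 UM VM /andP[t0 t1].
(* [omega] is controlled at positive arguments only, so a zero increment is treated apart. *)
have [V0|V0] := eqVneq V 0.
  rewrite V0 scaler0 addr0 subrr -[0 : jet](scale0r 0) jdotZr mul0r mulr0 subr0.
  by rewrite normr0 !mulr_ge0// ltW.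
have [s /andP[s0 st] ->] := jet_MVT U V dh t0.
rewrite -mulrBr normrM gtr0_norm// ler_pM2l//.
rewrite -mulN1r -jdotZl -jdotDl scaleN1r (le_trans (ler_norm_jdot _ _))//.
rewrite mulrC ler_pM//.
have sV : `|s *: V| <= M.
  by rewrite normrZ gtr0_norm// -[leRHS]mul1r ler_pM// ltW// (lt_trans st).
apply: (@le_trans _ _ (omega (s * `|V|))); last first.
  apply: le_trans (ler_norm _); apply: homega.
  - by rewrite in_itv/= andbT mulr_gt0// normr_gt0.
  - by rewrite in_itv/= andbT mulr_gt0.
  - by rewrite ler_pM// ltW.
have -> : s * `|V| = `|(U + s *: V) - U| by rewrite addrC addKr normrZ gtr0_norm.
apply: gomega.
- rewrite -ball_normE/= sub0r normrN (le_lt_trans (ler_normD _ _))//.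
  by move: UM sV; lra.
- by rewrite -ball_normE/= sub0r normrN; lra.
- by rewrite -subr_eq0 addrC addKr scaler_eq0 negb_or V0 gt_eqF.
Qed.

End jets.

(** The expression is the remainder factor of [taylor_modulus]. *)
Lemma cvg_at_right_scale (R : realType) (omega : R -> R) (M : R) :
  0 < M -> omega s @[s --> 0^'+] --> 0 ->
  (M * `|omega (t * M)|) @[t --> 0^'+] --> 0.
Proof.
move=> M0 omega0; rewrite -[X in _ --> X](mulr0 M); apply: cvgMl_tmp.
rewrite -[X in _ --> X](normr0 R); apply: cvg_norm.
apply: (cvg_comp (fun t => t * M) omega) omega0 => A [e /= e0 eA].
exists (e / M) => /=; first by rewrite divr_gt0.
move=> t /= te t0; apply: eA; last by rewrite /= mulr_gt0.
move: te; rewrite /= !sub0r !normrN normrM (gtr0_norm M0).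
by rewrite ltr_pdivlMr.
Qed.

(** * The supremal functional on Sobolev jets *)

Section sobolev_functional.
Context {R : realType} {n k N : nat} (Omega : set 'rV[R]_n)
  (H : 'rV[R]_n -> jet R N n k -> R).

Lemma Wkinf_bounded (u : Wkinf N k Omega) :
  exists M, {ae leb R n, forall x : lebT R n, Omega x -> `|u x| <= M}.
Proof. by case: u => u /= /asboolP[_ /ess_sup_on_lty]. Qed.

(* The exceptional null set in the hypothesis depends on the two jets; rational
   jets and continuity make it uniform. *)
Lemma ae_modulus (r : R) : 0 < r -> ess_uniformly_C1 Omega H ->
  exists2 omega : R -> R, modulus_of_continuity omega &
  {ae leb R n, forall x : lebT R n, Omega x -> is_C1 (H x) /\
    forall X X' : jet R N n k, ball 0 r X -> ball 0 r X' -> X != X' ->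
      `|H x X - H x X'| <= omega `|X - X'| /\
      `|gradient (H x) X - gradient (H x) X'| <= omega `|X - X'|}.
Proof.
move=> r0 [C1 /(_ r r0)[omega [momega Homega]]]; exists omega => //.
pose J := {ffun @jidx N n k -> rat}.
have rat_modulus : {ae leb R n, forall x : lebT R n, forall q : (J * J)%type,
    ball 0 r (rat_jet q.1 : jet R N n k) -> ball 0 r (rat_jet q.2 : jet R N n k) -> Omega x ->
    `|H x (rat_jet q.1) - H x (rat_jet q.2)| <=
      omega `|rat_jet q.1 - rat_jet q.2| /\
    `|gradient (H x) (rat_jet q.1) - gradient (H x) (rat_jet q.2)| <=
      omega `|rat_jet q.1 - rat_jet q.2| }.
  apply: ae_forall_count => -[q q'].
  have [qr|nqr] := pselect (ball 0 r (rat_jet q : jet R N n k)); last first.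
    by apply: nearW => x /nqr.
  have [qr'|nqr'] := pselect (ball 0 r (rat_jet q' : jet R N n k)); last first.
    by apply: nearW => x _ /nqr'.
  have [/ess_sup_onP H1 /ess_sup_onP H2] := Homega _ _ qr qr'.
  by apply: filterS2 H1 H2 => x H1 H2 _ _ Ox; split; [exact: H1|exact: H2].
have [_ comega _] := momega.
apply: filterS2 C1 rat_modulus => x C1x ratx Ox; have [dH cH] := C1x Ox.
split=> // X X' rX rX' XX'; split.
  apply: rat_jet_modulus rX rX' XX' => // [X0|q q' qr qr'].
    exact/differentiable_continuous/dH.
  exact: (ratx (q, q') qr qr' Ox).1.
apply: rat_jet_modulus rX rX' XX' => // q q' qr qr'.
exact: (ratx (q, q') qr qr' Ox).2.
Qed.

(** One real [l] serves both limits, so that semi-differentiability and the formula follow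
    together. *)
Lemma Einf_right_derivative (u phi : Wkinf N k Omega) :
  open Omega -> Omega !=set0 -> ess_uniformly_C1 Omega H ->
  (ess_sup_on Omega (fun x => `|H x 0|%R) < +oo)%E ->
  exists l : R,
    ess_sup_on
      [set x | Omega x /\ (Einf H u Omega - eps%:E <= (H x (u x))%:E)%E]
      (fun x => jdot (gradient (H x) (u x)) (phi x)) @[eps --> 0^'+] --> l%:E /\
    diff_quotient (fun v : Wkinf N k Omega => Einf H v Omega) u phi t
      @[t --> 0^'+] --> l%:E.
Proof.
move=> oO O0 C1 /ess_sup_on_lty[C0 H0C].
have [M1 uM] := Wkinf_bounded u; have [M2 phiM] := Wkinf_bounded phi.
(* A positive common bound for both jets; [r] below is then the radius that [taylor_modulus] asks
   for. *)
pose M := `|M1| + `|M2| + 1.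
have M0 : 0 < M by rewrite ltr_wpDl// addr_ge0.
have M1M : M1 <= M by have := ler_norm M1; have := normr_ge0 M2; rewrite /M; lra.
have M2M : M2 <= M by have := ler_norm M2; have := normr_ge0 M1; rewrite /M; lra.
pose r := M + M + 1; have r0 : 0 < r by rewrite /r; lra.
have [omega [homega _ omega0] mod_omega] := ae_modulus r0 C1.
pose f t x := H x (u x + t *: phi x).
pose g x := jdot (gradient (H x) (u x)) (phi x).
pose eta t := M * `|omega (t * M)|.
have f0E : f 0 = (fun x => H x (u x)).
  by apply/funext => x; rewrite /f scale0r addr0.
(* Operations on [Wkinf] act pointwise on jets, so this holds by conversion. *)
have fE t : Einf H (u + t *: phi) Omega = ess_sup_on Omega (f t) by [].
(* For [X] of norm below [r], comparing [H x X] with [H x 0] costs at most [omega r]. *)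
pose C := `|C0| + `|omega r|.
(* The bound at [t = 1/2] is recorded for the estimate of [g]. *)
have expand : {ae leb R n, forall x : lebT R n, Omega x ->
    [/\ `|H x (u x)| <= C, `|H x (u x + 2^-1 *: phi x)| <= C &
    forall t, 0 < t < 1 -> `|f t x - f 0 x - t * g x| <= t * eta t]}.
  near=> x => Ox.
  have ux : `|u x| <= M by apply: le_trans M1M; move: Ox; near: x.
  have phix : `|phi x| <= M by apply: le_trans M2M; move: Ox; near: x.
  have H0x : `|H x 0| <= `|C0|.
    by apply: le_trans (ler_norm C0); move: Ox; near: x.
  have [[dH _] modx] : is_C1 (H x) /\
    forall X X' : jet R N n k, ball 0 r X -> ball 0 r X' -> X != X' ->
      `|H x X - H x X'| <= omega `|X - X'| /\
      `|gradient (H x) X - gradient (H x) X'| <= omega `|X - X'|.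
    by move: Ox; near: x.
  have bound X : `|X| < r -> `|H x X| <= C.
    move=> Xr; have [->|X0] := eqVneq X 0; first by rewrite ler_wpDr.
    have [] := modx X 0 _ _ X0.
    - by rewrite -ball_normE/= sub0r normrN.
    - by rewrite -ball_normE/= subrr normr0.
    rewrite subr0 => HX _.
    have oX : omega `|X| <= `|omega r|.
      apply: le_trans (ler_norm _); apply: homega; last exact: ltW.
        by rewrite in_itv/= andbT normr_gt0.
      by rewrite in_itv/= andbT.
    rewrite -(subrK (H x 0) (H x X)) (le_trans (ler_normD _ _))// addrC.
    by rewrite lerD// (le_trans HX).
  split.
  - by apply: bound; rewrite /r; lra.
  - apply: bound; rewrite (le_lt_trans (ler_normD _ _))// normrZ gtr0_norm ?invr_gt0//.
    rewrite /r; lra.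
  - move=> t t01; rewrite f0E; apply: taylor_modulus => // X X' rX rX' XX'.
    exact: (modx X X' rX rX' XX').2.
have f0C : {ae leb R n, forall x : lebT R n, Omega x -> `|f 0 x| <= C}.
  by apply: filterS expand => x + Ox => /(_ Ox)[]; rewrite f0E.
(* No bound on the gradient is assumed: it comes from the Taylor estimate at
   t = 1/2 and the bounds on H. *)
pose G := 2 * (C + C + 2^-1 * eta 2^-1).
have gG : {ae leb R n, forall x : lebT R n, Omega x -> `|g x| <= G}.
  apply: filterS expand => x + Ox => /(_ Ox)[h0 h1 /(_ 2^-1)].
  rewrite invr_gt0 ltr0n invf_lt1// ltr1n f0E => /(_ isT).
  move: h0 h1; rewrite /G /f; set h0 := H x _; set h1 := H x _.
  set e := eta _; set y := g x.
  rewrite !ler_norml => /andP[? ?] /andP[? ?] /andP[? ?].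
  by apply/andP; split; lra.
have [|l [Ll Ql]] := danskin_ess_sup (open_not_negligible oO O0)
    (cvg_at_right_scale M0 omega0) f0C gG.
  by apply: filterS expand => x + Ox => /(_ Ox)[].
exists l; split; first by move: Ll; rewrite f0E.
rewrite /diff_quotient (_ : Einf H u Omega = ess_sup_on Omega (f 0)); last first.
  by rewrite f0E.
by under eq_fun do rewrite fE.
Unshelve. all: by end_near. Qed.

End sobolev_functional.

Theorem theorem5 (R : realType) (n k N : nat) (Omega : set 'rV[R]_n)
    (H : 'rV[R]_n -> jet R N n k -> R)
    (Omega_open : open Omega) (Omega_neq0 : Omega !=set0)
    (H_caratheodory : caratheodory_fun Omega H)
    (H_C1 : ess_uniformly_C1 Omega H)
    (H0_bounded : (ess_sup_on Omega (fun x => `|H x 0|%R) < +oo)%E) :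
  (forall u : Wkinf N k Omega,
     semi_differentiable (fun v : Wkinf N k Omega => Einf H v Omega) u) /\
  (forall u phi : Wkinf N k Omega,
     ess_sup_on
       [set x | Omega x /\ (Einf H u Omega - eps%:E <= (H x (u x))%:E)%E]
       (fun x => jdot (gradient (H x) (u x)) (phi x)) @[eps --> 0^'+] -->
     right_semiderivative (fun v : Wkinf N k Omega => Einf H v Omega) u phi).
Proof.
split=> u phi.
  have [l [_ Ql]] := Einf_right_derivative u phi Omega_open Omega_neq0 H_C1 H0_bounded.
  by exists l.
have [l [Ll Ql]] := Einf_right_derivative u phi Omega_open Omega_neq0 H_C1 H0_bounded.
by rewrite /right_semiderivative (cvg_lim _ Ql).
Qed.
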